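(* Let $1\le k<n$ be integers and $K=\{p\in[0,1]^n:\sum_i p_i=k\}$. There exists a sampling procedure which, given only sample access to $n$ coins of unknown biases $p=(p_1,\dots,p_n)\in K$ (independent Bernoulli($p_i$) flips of coin $i$, as many as desired) together with independent auxiliary coins of known biases, terminates almost surely for every $p\in K$ (including points on the boundary of $[0,1]^n$) and outputs a random subset $U\subseteq[n]$ with $|U|=k$ such that $\mathbb{P}[i\in U]=p_i$ for every $i\in[n]$. *)

(* Defs.v *)
From HB Require Import structures.
From mathcomp Require Import all_boot all_order all_algebra.
From mathcomp Require Import all_classical all_reals all_analysis.
Set Implicit Arguments. Unset Strict Implicit. Unset Printing Implicit Defensive.
Import Order.TTheory GRing.Theory Num.Theory.
Local Open Scope ring_scope.

(* A sampling procedure is a (possibly infinite) deterministic decision tree: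
   given the history of coin outcomes observed so far (a seq bool), it
   either flips unknown coin i, flips an auxiliary coin of known bias q,
   or halts and outputs a subset of [n]. *)
Inductive action (n : nat) (R : Type) :=
| FlipCoin of 'I_n
| FlipAux of R
| Output of {set 'I_n}.
Arguments FlipCoin {n R}.
Arguments FlipAux {n R}.
Arguments Output {n R}.

Definition procedure (n : nat) (R : Type) := seq bool -> action n R.

Section Semantics.
Variables (R : realType) (n : nat).

Definition valid_procedure (k : nat) (S : procedure n R) : Prop :=
  (forall h q, S h = FlipAux q -> 0 <= q <= 1) /\
  (forall h U, S h = Output U -> #|U| = k).

Definition step_prob (p : 'I_n -> R) (a : action n R) (b : bool) : R :=
  match a with
  | FlipCoin i => if b then p i else 1 - p i
  | FlipAux q => if b then q else 1 - q
  | Output _ => 0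
  end.

Definition hist_prob (S : procedure n R) (p : 'I_n -> R) (h : seq bool) : R :=
  \prod_(j < size h) step_prob p (S (take j h)) (nth false h j).

Definition outputs (S : procedure n R) (h : seq bool) (U : {set 'I_n}) : bool :=
  match S h with Output V => V == U | _ => false end.

Definition prob_out_within (S : procedure n R) (p : 'I_n -> R)
    (U : {set 'I_n}) (t : nat) : R :=
  \sum_(j < t.+1) \sum_(h : j.-tuple bool)
     (if outputs S h U then hist_prob S p h else 0).

Definition in_K (k : nat) (p : 'I_n -> R) : Prop :=
  (forall i, 0 <= p i <= 1) /\ \sum_i p i = k%:R.

End Semantics.

(* Main.v *)
Require Import Defs.
From HB Require Import structures.
From mathcomp Require Import all_boot all_order all_algebra.
From mathcomp Require Import all_classical all_reals all_analysis.
From mathcomp Require Import ring lra.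
Import Order.TTheory GRing.Theory Num.Theory numFieldNormedType.Exports.
Local Open Scope classical_set_scope.
Local Open Scope ring_scope.

Set Implicit Arguments.
Unset Strict Implicit.
Unset Printing Implicit Defensive.

                                                                                
                                                                               
                                                                              
                                                                              
                                           
                                                                     
                                                                                 
                                                                               
                                                                                                 
                                                                             
                                                                        
                                                                

(** One round of the sampler flips every coin once, which yields a set W with probability Q(W), the
    product of p_i over W and of 1 - p_i off W. If |W| = k, W is output. Otherwise an index j is
    drawn with probability v_j / h, where v_j = p_j (1 - p_j) and h is the sum of the v_j, and j is
    toggled in W; the result is output if it has k elements, else a new round begins. The draw
    requires no knowledge of p: pick an index uniformly, flip its coin twice, accept on heads then
    tails, and retry otherwise.

    Let law(U) be the probability that a round outputs the k-set U. Toggling j exchanges the factors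
    p_j and 1 - p_j of Q, whence h law(U) = 2 Q(U) D(U), where D(U) is the sum of 1 - p_j over U
    ([law_defect]). This is Sampford's design, and an exchange of two indices shows that its
    inclusion probabilities are the p_i ([sampford], [marginal_law]). A round succeeds with positive
    probability ([sum_law_gt0]), so the output follows the normalised law ([prob_run_start_law]),
    whose total mass 1 is almost sure termination. At a vertex of the cube h = 0, but there the
    initial flips give a k-set with certainty ([vertex_card]). *)

Lemma sum_tupleS (V : nmodType) (T : finType) (m : nat) (F : seq T -> V) :
  \sum_(h : m.+1.-tuple T) F h = \sum_b \sum_(h : m.-tuple T) F (b :: h).
Proof.
rewrite pair_big /=.
rewrite (reindex (fun bh : T * m.-tuple T => cons_tuple bh.1 bh.2)) //=.
exists (fun h => (thead h, [tuple of behead h])) => [[b h]|h] _.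
  by congr pair; apply: val_inj.
by rewrite [RHS]tuple_eta; apply: val_inj.
Qed.

(** * First-step analysis of decision trees *)

Section Semantics.
Variables (R : realType) (n : nat).
Implicit Types (S : procedure n R) (p : 'I_n -> R) (U : {set 'I_n}).

Definition after S (b : bool) : procedure n R := fun h => S (b :: h).

Lemma valid_after k S b : valid_procedure k S -> valid_procedure k (after S b).
Proof. by move=> [auxS outS]; split=> h *; [apply: auxS | apply: outS]; eauto. Qed.

Lemma hist_prob_cons S p b h :
  hist_prob S p (b :: h) = step_prob p (S [::]) b * hist_prob (after S b) p h.
Proof. by rewrite /hist_prob big_ord_recl. Qed.

Lemma prob_out_within0 S p U :
  prob_out_within S p U 0 = (outputs S [::] U)%:R.
Proof.
rewrite /prob_out_within big_ord1 (big_pred1 [tuple]) => [|t]; last first.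
  by apply/esym/eqP; apply: val_inj; rewrite (tuple0 t).
by rewrite /hist_prob big_ord0 /=; case: outputs.
Qed.

(** Conditioning on the first outcome. The two terms never both contribute: [step_prob] vanishes at
    an [Output] node, so histories running past a halt carry no mass. *)
Lemma prob_out_withinS S p U t :
  prob_out_within S p U t.+1 = (outputs S [::] U)%:R +
    \sum_(b : bool) step_prob p (S [::]) b * prob_out_within (after S b) p U t.
Proof.
rewrite /prob_out_within big_ord_recl; congr (_ + _).
  by rewrite -(prob_out_within0 S p U) /prob_out_within big_ord1.
under [RHS]eq_bigr do rewrite big_distrr /=.
rewrite [RHS]exchange_big /=; apply: eq_bigr => j _.
apply: etrans (@sum_tupleS _ _ _
  (fun h => if outputs S h U then hist_prob S p h else 0)) _.
apply: eq_bigr => b _; rewrite big_distrr; apply: eq_bigr => h _ /=.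
by rewrite /outputs hist_prob_cons /after; case: ifP; rewrite ?mulr0.
Qed.

Definition prob_out S p U : R := lim (prob_out_within S p U @ \oo).

Section Convergence.
Variables (k : nat) (p : 'I_n -> R).
Hypothesis p01 : forall i, 0 <= p i <= 1.

Lemma step_prob_ge0 S b : valid_procedure k S -> 0 <= step_prob p (S [::]) b.
Proof.
move=> [auxS _]; case E: (S [::]) => [i|q|V] //=.
  by have /andP[] := p01 i; case: b => //; rewrite subr_ge0.
by have /andP[] := auxS _ _ E; case: b => //; rewrite subr_ge0.
Qed.

Lemma prob_out_within_ge0 S U t :
  valid_procedure k S -> 0 <= prob_out_within S p U t.
Proof.
elim: t S => [|t IH] S vS; first by rewrite prob_out_within0.
rewrite prob_out_withinS addr_ge0// sumr_ge0// => b _.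
by rewrite mulr_ge0 ?step_prob_ge0 ?IH//; apply: valid_after.
Qed.

Lemma prob_out_within_nondecreasing S U : valid_procedure k S ->
  nondecreasing_seq (prob_out_within S p U).
Proof.
move=> vS; apply/nondecreasing_seqP => t; elim: t S vS => [|t IH] S vS.
  rewrite prob_out_within0 prob_out_withinS lerDl sumr_ge0// => b _.
  by rewrite mulr_ge0 ?step_prob_ge0 ?prob_out_within_ge0//; apply: valid_after.
rewrite !(prob_out_withinS S) lerD2l ler_sum// => b _.
by rewrite ler_wpM2l ?step_prob_ge0// IH//; apply: valid_after.
Qed.

Lemma prob_out_within_le1 S U t :
  valid_procedure k S -> prob_out_within S p U t <= 1.
Proof.
elim: t S => [|t IH] S vS.
  by rewrite prob_out_within0; case: outputs.
rewrite prob_out_withinS.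
have le_step : \sum_(b : bool) step_prob p (S [::]) b *
    prob_out_within (after S b) p U t <= \sum_(b : bool) step_prob p (S [::]) b.
  apply: ler_sum => b _; rewrite ler_piMr ?step_prob_ge0// IH//.
  exact: valid_after.
apply: (le_trans (lerD (lexx _) le_step)).
rewrite big_bool /outputs; case: (S [::]) => [i|q|V] /=.
- by rewrite add0r addrC subrK.
- by rewrite add0r addrC subrK.
- by rewrite !addr0; case: eqP.
Qed.

Lemma cvg_prob_out S U : valid_procedure k S ->
  prob_out_within S p U @ \oo --> prob_out S p U.
Proof.
move=> vS; apply: nondecreasing_is_cvgn; first exact: prob_out_within_nondecreasing.
by exists 1 => _ [t _ <-]; apply: prob_out_within_le1.
Qed.

(** The limit of the finite-time recursion. The output probabilities of the machine below are all
    derived from this equation. *)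
Lemma prob_out_step S U : valid_procedure k S ->
  prob_out S p U = (outputs S [::] U)%:R +
    \sum_(b : bool) step_prob p (S [::]) b * prob_out (after S b) p U.
Proof.
move=> vS; apply/cvg_lim => //; rewrite -cvg_shiftS.
under eq_fun do rewrite prob_out_withinS.
apply: cvgD; first exact: cvg_cst.
rewrite big_bool /=; under eq_fun do rewrite big_bool /=.
by apply: cvgD; apply: cvgMl_tmp; apply: cvg_prob_out; apply: valid_after.
Qed.

End Convergence.
End Semantics.

(** * Toggling one element of a finite set *)

Definition toggle (T : finType) (j : T) (W : {set T}) : {set T} :=
  [set i | (i \in W) (+) (i == j)]%SET.

Section Toggle.
Variable T : finType.
Implicit Types (i j : T) (W : {set T}).

Lemma in_toggle i j W : (i \in toggle j W) = (i \in W) (+) (i == j).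
Proof. by rewrite inE. Qed.

Lemma toggleK j : involutive (toggle j).
Proof. by move=> W; apply/setP => i; rewrite !in_toggle addbK. Qed.

Lemma card_toggle j W :
  #|toggle j W| = if j \in W then #|W|.-1 else #|W|.+1.
Proof.
case: ifP => jW.
  suff -> : toggle j W = W :\ j by rewrite (cardsD1 j W) jW.
  by apply/setP => i; rewrite in_toggle !inE; case: eqP => [->|]; rewrite ?jW ?addbF.
suff -> : toggle j W = j |: W by rewrite cardsU1 jW.
by apply/setP => i; rewrite in_toggle !inE; case: eqP => [->|]; rewrite ?jW ?addbF.
Qed.

Lemma card_toggle_neq j W : (#|toggle j W| == #|W|) = false.
Proof.
rewrite card_toggle; case: ifP => [jW|_]; last by rewrite gtn_eqF.
by rewrite (cardsD1 j) jW ltn_eqF.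
Qed.

Lemma exists_card_between (A C : {set T}) (k : nat) :
  A \subset C -> (#|A| <= k <= #|C|)%N ->
  exists B : {set T}, [/\ A \subset B, B \subset C & #|B| = k].
Proof.
move=> sAC /andP[]; elim: k => [|k IH] leA leC.
  by exists A; split=> //; apply/eqP; rewrite -leqn0.
move: leA; rewrite leq_eqVlt => /predU1P[<-|leA]; first by exists A.
have [B [sAB sBC cB]] := IH leA (ltnW leC).
have /properP[_ [x xC xB]] : B \proper C by rewrite properEcard sBC cB.
exists (x |: B); split; last by rewrite cardsU1 xB cB.
  by rewrite (fintype.subset_trans sAB) ?finset.subsetUr.
by rewrite finset.subUset finset.sub1set xC.
Qed.
End Toggle.

(** * The sampling machine and its output probabilities *)

(** Programs are finite trees; loops arise because [next] sends a [Race] leaf, or an [Emit] leaf of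
    wrong size, to a freshly built tree. *)
Inductive prog (n : nat) :=
| Emit of {set 'I_n}
| Race of {set 'I_n}
| Coin of 'I_n & prog n & prog n
| Pick of nat & prog n & prog n.

Section Machine.
Variables (R : realType) (n k : nat).
Implicit Types (x : prog n) (U V W B : {set 'I_n}) (i j : 'I_n) (s : seq 'I_n).

Definition settle W : prog n := if #|W| == k then Emit W else Race W.

Fixpoint flip_all s W : prog n :=
  if s is i :: s' then Coin i (flip_all s' (i |: W)) (flip_all s' (W :\ i))
  else settle W.

Definition start : prog n := flip_all (enum 'I_n) finset.set0.

                                                                            
                            
(** Successive picks of bias 1 / [size s] choose an index uniformly. The last pick has bias 1, so
    the branch to the empty list is taken with probability 0. *)
Fixpoint race W s : prog n :=
  if s is j :: s' then
    Pick (size s')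
      (Coin j (Coin j (Race W) (Emit (toggle j W))) (Race W))
      (race W s')
  else Race W.

                                                                              
                                         
(** A node that does not halt must flip something, so bookkeeping transitions flip a coin of bias 0,
    whose outcome [next] ignores. *)
Definition act x : action n R :=
  match x with
  | Emit U => if #|U| == k then Output U else FlipAux 0
  | Race _ => FlipAux 0
  | Coin i _ _ => FlipCoin i
  | Pick m _ _ => FlipAux m.+1%:R^-1
  end.

Definition next x (b : bool) : prog n :=
  match x with
  | Emit _ => start
  | Race W => race W (enum 'I_n)
  | Coin _ t f | Pick _ t f => if b then t else f
  end.

Definition run x : procedure n R := fun h => act (foldl next x h).

Lemma valid_run x : valid_procedure k (run x).
Proof.
split=> h; rewrite /run; case: foldl => [V|V|i t f|m t f] //=.
- by case: ifP => // _ q [<-]; rewrite lexx ler01.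
- by move=> q [<-]; rewrite lexx ler01.
- by move=> q [<-]; rewrite invr_ge0 ler0n invf_le1 ?ltr0n ?ler1n.
- by case: eqP => // kV U [<-].
Qed.

Variable p : 'I_n -> R.
Hypothesis p01 : forall i, 0 <= p i <= 1.
Variable U : {set 'I_n}.

Let g x := prob_out (run x) p U.

Lemma prob_run_step x : g x = (outputs (run x) [::] U)%:R +
  (step_prob p (act x) true * g (next x true) +
   step_prob p (act x) false * g (next x false)).
Proof. by rewrite {1}/g (prob_out_step p01 _ (valid_run x)) big_bool. Qed.

Lemma prob_run_emit V : g (Emit V) = if #|V| == k then (V == U)%:R else g start.
Proof.
rewrite prob_run_step /outputs /run /=; case: ifP => _ /=.
  by rewrite !mul0r !addr0.
by rewrite mul0r subr0 mul1r !add0r.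
Qed.

Lemma prob_run_race W : g (Race W) = g (race W (enum 'I_n)).
Proof. by rewrite prob_run_step /outputs /= mul0r subr0 mul1r !add0r. Qed.

Lemma prob_run_coin i t f : g (Coin i t f) = p i * g t + (1 - p i) * g f.
Proof. by rewrite prob_run_step /outputs /= add0r. Qed.

Lemma prob_run_pick m t f :
  m.+1%:R * g (Pick m t f) = g t + m%:R * g f.
Proof.
rewrite prob_run_step /outputs /= add0r mulrDr !mulrA mulrBr mulr1.
by rewrite divff ?pnatr_eq0// mul1r -natr1 addrK.
Qed.

Definition factor W i : R := if i \in W then p i else 1 - p i.
Definition weight W : R := \prod_i factor W i.
Definition variance i : R := p i * (1 - p i).
Let h : R := \sum_i variance i.

(** Coordinates outside [s] are frozen at their value in [W], hence the 0/1 factors; the others are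
    independent flips. *)
Lemma prob_run_flip_all s W : uniq s ->
  g (flip_all s W) = \sum_B
    (\prod_i if i \in s then factor B i else ((i \in B) == (i \in W))%:R) *
    g (settle B).
Proof.
elim: s W => [|i s IH] W /=.
  move=> _; rewrite (bigD1 W) //= big1 ?mul1r => [|i _]; last by rewrite eqxx.
  rewrite big1 ?addr0 // => B; apply: contraNeq.
  rewrite mulf_eq0 negb_or => /andP[+ _] => /prodf_neq0 BW.
  apply/eqP/setP => i; apply/eqP.
  by apply: contraNT (BW i isT) => /negbTE ->.
move=> /andP[iNs us]; rewrite prob_run_coin !IH // !big_distrr -big_split /=.
apply: eq_bigr => B _; rewrite !(bigD1 (P := xpredT) i) //= (negbTE iNs) mem_head.
(* Away from [i], both [i |: W] and [W :\ i] agree with [W], so the three products coincide. *)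
set q := \prod_(j | j != i) _; set q' := \prod_(j | j != i) _.
set q'' := \prod_(j | j != i) _.
have -> : q = q''.
  apply: eq_bigr => j ji; rewrite !inE (negbTE ji) /=.
  by case: ifP.
have -> : q' = q''.
  apply: eq_bigr => j ji; rewrite !inE (negbTE ji) /=.
  by case: ifP.
rewrite /factor !inE eqxx /=; case: (i \in B) => /=; ring.
Qed.

Lemma prob_run_start : g start = \sum_B weight B * g (settle B).
Proof.
rewrite prob_run_flip_all ?enum_uniq//; apply: eq_bigr => B _.
by congr (_ * _); apply: eq_bigr => i _; rewrite mem_enum.
Qed.

Lemma prob_run_scan W s : (size s)%:R * g (race W s) =
  \sum_(j <- s) (variance j * g (Emit (toggle j W)) +
                 (1 - variance j) * g (Race W)).
Proof.
elim: s => [|j s IH]; first by rewrite big_nil mul0r.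
rewrite big_cons prob_run_pick IH !prob_run_coin /variance; congr (_ + _); ring.
Qed.

(** One pass of the race gives n g(Race W) as the sum of the v_j g(Emit) plus (n - h) g(Race W), and
    n cancels. The form multiplied by [h] stays valid when [h] is 0. *)
Lemma prob_run_race_toggle W :
  h * g (Race W) = \sum_j variance j * g (Emit (toggle j W)).
Proof.
have := prob_run_scan W (enum 'I_n).
rewrite -prob_run_race big_enum /= big_split /= -mulr_suml sumrB sumr_const.
rewrite -cardE mulrBl; set a := _ * g _; set b := h * _; lra.
Qed.
End Machine.

(** * The law of one round and the renewal equation *)

Section Law.
Variables (R : realType) (n k : nat) (p : 'I_n -> R).
Hypothesis p01 : forall i, 0 <= p i <= 1.
Hypothesis sum_p : \sum_i p i = k%:R.
Implicit Types (U V W B : {set 'I_n}) (i j : 'I_n) (s : seq 'I_n).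

Local Notation Q := (weight p).
Local Notation f := (factor p).
Local Notation v := (variance p).
Local Notation tog := toggle.
Let h : R := \sum_i v i.

                                                                         
(** The flips give [U] at once, or they give a neighbour [tog j U], which necessarily has another
    size, and the race then draws [j]. *)
Definition law U : R :=
  if #|U| == k then Q U + \sum_j v j / h * Q (tog j U) else 0.

Lemma factor_ge0 W i : 0 <= f W i.
Proof. by rewrite /factor; have /andP[] := p01 i; case: ifP; lra. Qed.

Lemma weight_ge0 W : 0 <= Q W.
Proof. by apply: prodr_ge0 => i _; apply: factor_ge0. Qed.

Lemma variance_ge0 i : 0 <= v i.
Proof. by have /andP[] := p01 i => *; rewrite mulr_ge0 ?subr_ge0. Qed.

Lemma sum_weight : \sum_W Q W = 1.
Proof.
rewrite /weight /factor -(bigA_distr _ _ p (fun i => 1 - p i)) big1 // => i _.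
by rewrite /= addrC subrK.
Qed.

(** Toggling [j] turns the factor [f W j] into [1 - f W j] and leaves the others alone. *)
Lemma weight_toggle W j : (1 - f W j) * Q W = f W j * Q (tog j W).
Proof.
rewrite /weight !(bigD1 (P := xpredT) j) //= !mulrA; congr (_ * _).
  by rewrite /factor in_toggle eqxx; case: (j \in W) => /=; ring.
by apply: eq_bigr => i ij; rewrite /factor in_toggle (negbTE ij) addbF.
Qed.

Lemma variance_factor W j : v j = f W j * (1 - f W j).
Proof. by rewrite /variance /factor; case: ifP => _; ring. Qed.

(** A zero sum of nonnegative variances makes every p_i equal to 0 or 1, and a nonzero weight then
    identifies [W]. *)
Lemma vertex_weight W : h = 0 -> Q W != 0 -> forall i, p i = (i \in W)%:R.
Proof.
move=> h0 /prodf_neq0 fW i; have := fW i isT.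
have /eqP : v i = 0 by apply: (psumr_eq0P _ h0) => // j _; apply: variance_ge0.
rewrite (variance_factor W) mulf_eq0 /factor => /orP[->//|].
by case: (i \in W) => /eqP + _ => /=; lra.
Qed.

Lemma vertex_card W : h = 0 -> Q W != 0 -> #|W| = k.
Proof.
move=> h0 /(vertex_weight h0) pW; apply/eqP; rewrite -(eqr_nat R) -sum_p.
rewrite -sum1_card natr_sum big_mkcond; apply/eqP/eq_bigr => i _ /=.
by rewrite pW; case: ifP.
Qed.

                                                
(** The probability that a round ends in rejection. *)
Let r : R := \sum_(W : {set 'I_n} | #|W| != k) Q W *
  \sum_(j | #|tog j W| != k) v j / h.

(** The expected payoff of a round that pays [phi] on the accepted set and [z] on rejection. An
    indicator [phi] gives the renewal equation; constants 1 give the total mass. *)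
Lemma round_sum (phi : {set 'I_n} -> R) (z : R) :
  \sum_W Q W * (if #|W| == k then phi W else
    \sum_j v j / h * (if #|tog j W| == k then phi (tog j W) else z)) =
  \sum_U law U * phi U + r * z.
Proof.
rewrite (bigID (fun W => #|W| == k)) /= [in RHS](bigID (fun W => #|W| == k)) /=.
rewrite [X in _ = _ + X + _]big1 => [|W /negbTE kW]; last first.
  by rewrite /law kW mul0r.
rewrite addr0; under eq_bigr => W kW do rewrite kW.
under [X in _ + X]eq_bigr => W /negbTE kW.
  rewrite kW (bigID (fun j => #|tog j W| == k)) /= mulrDr.
  under eq_bigr => j kj do rewrite kj.
  under [X in _ + _ * X]eq_bigr => j /negbTE kj do rewrite kj.
  rewrite -mulr_suml big_distrr /= mulrA.
over.
rewrite big_split /= addrA -mulr_suml; congr (_ + _).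
under [RHS]eq_bigr => W kW do rewrite /law kW mulrDl mulr_suml.
rewrite big_split /=; congr (_ + _).
rewrite (exchange_big_dep xpredT) //= [RHS]exchange_big /=.
(* Reindex by the toggled set. Toggling changes the size, so the condition that the flipped set not
   have size [k] becomes automatic. *)
apply: eq_bigr => j _; rewrite (reindex_inj (inv_inj (toggleK j))) /=.
apply: eq_big => [W|W _]; rewrite toggleK; last by ring.
by case: (#|W| =P k) => [<-|]; rewrite ?card_toggle_neq ?andbF.
Qed.

Lemma prob_run_round U (g := fun x => prob_out (run R k x) p U) :
  law U + r * g (start n k) = g (start n k).
Proof.
rewrite [RHS]/g (prob_run_start _ p01) /=.
transitivity (\sum_V law V * (V == U)%:R + r * g (start n k)).
  congr (_ + _); rewrite (bigD1 U) //= eqxx mulr1 big1 ?addr0 // => V.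
  by move=> /negbTE ->; rewrite mulr0.
rewrite -round_sum; apply: eq_bigr => W _.
(* Sets of weight 0 go first: for the remaining ones, [h] = 0 would force size [k], so [h] can be
   cancelled whenever a race takes place. *)
have [->|QW] := eqVneq (Q W) 0; first by rewrite !mul0r.
congr (_ * _); rewrite /settle; case: ifP => kW.
  by rewrite (prob_run_emit _ p01) kW.
have h_neq0 : h != 0 by apply: contraFN kW => /eqP h0; rewrite (vertex_card h0 QW).
apply: (mulfI h_neq0); rewrite (prob_run_race_toggle _ p01) mulr_sumr.
apply: eq_bigr => j _; rewrite (prob_run_emit _ p01).
by rewrite mulrA mulrCA divff// mulr1.
Qed.

Lemma sum_law : \sum_U law U + r = 1.
Proof.
have := round_sum (fun=> 1) 1; under [X in _ = X + _]eq_bigr do rewrite mulr1.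
rewrite mulr1 => <-; rewrite -[RHS]sum_weight; apply: eq_bigr => W _.
have [->|QW] := eqVneq (Q W) 0; first by rewrite mul0r.
rewrite -[RHS]mulr1; congr (_ * _); case: ifP => // kW.
have h_neq0 : h != 0 by apply: contraFN kW => /eqP h0; rewrite (vertex_card h0 QW).
under eq_bigr do rewrite if_same mulr1.
by rewrite -mulr_suml divff.
Qed.

(** A k-set that contains every i with p_i = 1 and no i with p_i = 0 has positive weight. It exists
    because the sum k of the p_i lies between the number of ones and the number of nonzero
    entries. *)
Lemma sum_law_gt0 : 0 < \sum_U law U.
Proof.
have [U [p1U p0U kU]] : exists U, [/\ [set i | p i == 1]%SET \subset U,
    U \subset [set i | p i != 0]%SET & #|U| = k].
  apply: exists_card_between.
    by apply/fintype.subsetP => i; rewrite !inE => /eqP ->; rewrite oner_eq0.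
  rewrite -!(ler_nat R) -sum_p -!sum1_card !natr_sum.
  rewrite !(big_mkcond (fun i => i \in _)) /=.
  apply/andP; split; apply: ler_sum => i _; rewrite inE.
    by case: eqP => [->//|_]; have /andP[] := p01 i.
  by case: eqP => [->//|_]; have /andP[] := p01 i.
have QU : 0 < Q U.
  apply: prodr_gt0 => i _; rewrite lt_neqAle factor_ge0 andbT eq_sym /factor.
  case: ifPn => iU; first by have := fintype.subsetP p0U i iU; rewrite inE.
  apply: contraNneq iU => pi0; apply: (fintype.subsetP p1U).
  by rewrite inE eq_sym -subr_eq0 pi0.
have law_ge0 V : 0 <= law V.
  rewrite /law; case: ifP => // _; rewrite addr_ge0 ?weight_ge0// sumr_ge0// => j _.
  rewrite mulr_ge0 ?weight_ge0// divr_ge0 ?variance_ge0 ?sumr_ge0// => i _.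
  exact: variance_ge0.
rewrite (bigD1 U) //= ltr_wpDr ?sumr_ge0// /law kU eqxx ltr_wpDr//.
rewrite sumr_ge0// => j _; rewrite mulr_ge0 ?weight_ge0//.
by rewrite divr_ge0 ?variance_ge0 ?sumr_ge0// => i _; exact: variance_ge0.
Qed.

(** Solves x = law(U) + r x, where 1 - r is the total of [law] and is positive. *)
Lemma prob_run_start_law U :
  prob_out (run R k (@start n k)) p U = law U / \sum_V law V.
Proof.
have sum_neq0 := lt0r_neq0 sum_law_gt0; have E := prob_run_round U.
apply: (mulIf sum_neq0); rewrite divfK// -[in LHS](addrK r (\sum_V law V)) sum_law.
by rewrite mulrBr mulr1 -{1}E mulrC addrK.
Qed.

(** * Sampford's identity and the inclusion probabilities *)

Definition defect U : R := \sum_(j in U) (1 - p j).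

Lemma defectC U : #|U| = k -> defect U = \sum_(j | j \notin U) p j.
Proof.
move=> kU; rewrite /defect sumrB sumr_const kU -sum_p.
by rewrite (bigID (fun j => j \in U)) /= addrAC subrr add0r.
Qed.

(** With f = [f U j], the terms v_j Q(U) = f (1 - f) Q(U) and v_j Q([tog j U]) = (1 - f)^2 Q(U) add
    up to (1 - f) Q(U). The sums of 1 - f inside and outside [U] both equal [defect U], whence the
    2. *)
Lemma law_defect U : #|U| = k -> h != 0 -> h * law U = 2 * (Q U * defect U).
Proof.
move=> kU h_neq0; rewrite /law kU eqxx mulrDr mulr_sumr.
have -> : 2 * (Q U * defect U) = \sum_j (1 - f U j) * Q U.
  rewrite -mulr_suml (bigID (fun j => j \in U)) /=.
  have -> : \sum_(j in U) (1 - f U j) = defect U.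
    by apply: eq_bigr => j jU; rewrite /factor jU.
  have -> : \sum_(j | j \notin U) (1 - f U j) = defect U; last by ring.
  by rewrite defectC//; apply: eq_bigr => j /negbTE jU; rewrite /factor jU subKr.
rewrite mulr_suml -big_split; apply: eq_bigr => j _ /=.
rewrite mulrA [h * _]mulrC divfK// (variance_factor U).
rewrite [f U j * _]mulrC -[X in _ + X]mulrA -weight_toggle; ring.
Qed.

                                                                         
                                                          
(** Expand the left defect over j outside [U] ([defectC]) and the right one over j in [U]. For j = i
    both sums are empty. Otherwise exchanging i and j in [U] matches the terms: each is p_i (1 -
    p_i) p_j (1 - p_j) times the factors of the other indices. *)
Lemma sampford i :
  \sum_(U : {set 'I_n} | (#|U| == k) && (i \in U)) Q U * defect U * (1 - p i) =
  \sum_(U : {set 'I_n} | (#|U| == k) && (i \notin U)) Q U * defect U * p i.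
Proof.
under eq_bigr => U /andP[/eqP kU _] do
  rewrite defectC// mulr_sumr mulr_suml.
under [RHS]eq_bigr => U _ do rewrite /defect mulr_sumr mulr_suml.
rewrite (exchange_big_dep xpredT) //= [RHS](exchange_big_dep xpredT) //=.
apply: eq_bigr => j _; have [<-|ij] := eqVneq i j.
  by rewrite !big_pred0 // => U; case: (i \in U); rewrite ?andbF.
have inj : injective (fun U => tog i (tog j U)).
  by move=> U V /(inv_inj (toggleK i)) /(inv_inj (toggleK j)).
rewrite [RHS](reindex_inj inj) /=; apply: eq_big => [U|U /andP[/andP[_ iU] jU]].
  rewrite !card_toggle !in_toggle !eqxx [j == i]eq_sym (negbTE ij) !addbF !addbT negbK.
  case: (boolP (i \in U)) => iU; case: (boolP (j \in U)) => jU; rewrite /= ?andbF//.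
have := weight_toggle U j; have := weight_toggle (tog j U) i.
rewrite /factor in_toggle (negbTE ij) iU (negbTE jU) /= subKr => Ei Ej.
by rewrite [Q U * _]mulrC Ej -mulrA [Q _ * _]mulrC Ei; ring.
Qed.

Lemma marginal_law i : \sum_(U : {set 'I_n} | i \in U) law U = p i * \sum_U law U.
Proof.
have [h0|h_neq0] := eqVneq h 0.
  (* At a vertex the claim holds term by term: where [law U] is nonzero, p_i is the indicator of i
     in [U]. *)
  rewrite mulr_sumr big_mkcond; apply: eq_bigr => U _.
  have lawE : law U = if #|U| == k then Q U else 0.
    rewrite /law; case: ifP => // _; rewrite big1 ?addr0// => j _.
    by rewrite h0 invr0 mulr0 mul0r.
  have [QU|QU] := eqVneq (Q U) 0.
    by rewrite lawE QU if_same mulr0; case: ifP.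
  by rewrite (vertex_weight h0 QU i); case: ifP; rewrite ?mul1r ?mul0r.
apply: (mulfI h_neq0); rewrite mulrCA [LHS]mulr_sumr [h * _]mulr_sumr.
have lawE (P : pred {set 'I_n}) : \sum_(U : {set 'I_n} | P U) h * law U =
    2 * \sum_(U : {set 'I_n} | (#|U| == k) && P U) Q U * defect U.
  rewrite mulr_sumr big_mkcondl; apply: eq_bigr => U _; case: eqP => kU.
    exact: law_defect.
  by rewrite /law; case: eqP => //; rewrite mulr0.
rewrite !lawE mulrCA; congr (_ * _).
under [in RHS]eq_bigl do rewrite andbT.
rewrite [in RHS](bigID (fun U : {set 'I_n} => i \in U)) /=.
(* With A and B the sums of Q times defect over the k-sets with and without i, [sampford] reads A (1
   - p_i) = B p_i, that is, A = p_i (A + B). *)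
have := sampford i; rewrite -!mulr_suml; lra.
Qed.
End Law.

Theorem theorem3 (R : realType) (n k : nat) (hk1 : (1 <= k)%N) (hkn : (k < n)%N) :
  exists S : procedure n R,
    valid_procedure k S /\
    forall p : 'I_n -> R, in_K k p ->
      exists pr : {set 'I_n} -> R,
        (forall U, prob_out_within S p U @ \oo --> pr U) /\
        \sum_(U : {set 'I_n}) pr U = 1 /\
        (forall i : 'I_n, \sum_(U : {set 'I_n} | i \in U) pr U = p i).
Proof.
exists (run R k (@start n k)); split; first exact: valid_run.
move=> p [p01 sum_p]; exists (prob_out (run R k (@start n k)) p).
have sum_neq0 := lt0r_neq0 (sum_law_gt0 p01 sum_p).
split=> [U|]; first by apply: (cvg_prob_out p01); apply: valid_run.
split=> [|i]; under eq_bigr do rewrite (prob_run_start_law p01 sum_p).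
  by rewrite -mulr_suml divff.
by rewrite -mulr_suml (marginal_law p01 sum_p) mulfK.
Qed.
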